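(* Let $\mathbb{K}$ be a field of characteristic different from $2$ and let $A=(V,\mu)$ be a $3$-dimensional skew-symmetric $\mathbb{K}$-algebra. If $A$ is a Lie algebra, then the rank of $M_\mu$ is smaller than or equal to $6$.
   Context: A skew-symmetric $\mathbb{K}$-algebra is a vector space $V$ with a bilinear map $\mu:V\times V\to V$ satisfying $\mu(X,Y)=-\mu(Y,X)$. Fix a basis $\{e_1,e_2,e_3\}$ of $V$. For $f\in \mathrm{End}(V)$ put $\delta_\mu f(X,Y)=\mu(f(X),Y)+\mu(X,f(Y))-f(\mu(X,Y))$. If $f$ has matrix $(f_{ij})$ in the basis, let $v_f=(f_{1,1},f_{2,1},f_{3,1},f_{1,2},f_{2,2},f_{3,2},f_{1,3},f_{2,3},f_{3,3})\in\mathbb{K}^9$. The matrix $M_\mu$ is the $9\times 9$ matrix determined by the requirement that for every $f$, the product $M_\mu\cdot{}^tv_f$ is the column vector in $\mathbb{K}^9$ obtained by stacking the coordinate columns of $\delta_\mu f(e_1,e_2)$, $\delta_\mu f(e_1,e_3)$, $\delta_\mu f(e_2,e_3)$. *)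

(* Defs.v *)
From HB Require Import structures.
From mathcomp Require Import all_boot all_order all_algebra.

Set Implicit Arguments.
Unset Strict Implicit.
Unset Printing Implicit Defensive.

Import GRing.Theory.
Local Open Scope ring_scope.

Section Algebra.
Variables (K : fieldType) (V : vectType K).
Implicit Types (mu : {bilinear V -> V -> V}) (f : 'End(V)).

Definition skew_symmetric mu : Prop := forall x y : V, mu x y = - mu y x.

Definition jacobi mu : Prop :=
  forall x y z : V, mu (mu x y) z + mu (mu y z) x + mu (mu z x) y = 0.

Definition lie_algebra mu : Prop := skew_symmetric mu /\ jacobi mu.

(* [delta mu f] vanishes iff [f] is a derivation of [(V, mu)]. *)
Definition delta mu f (x y : V) : V := mu (f x) y + mu x (f y) - f (mu x y).

Variable e : 3.-tuple V.

Definition coords (x : V) : 'cV[K]_3 := \col_i coord e i x.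

Definition stack (x y z : V) : 'cV[K]_9 :=
  col_mx (col_mx (coords x) (coords y)) (coords z).

(* The matrix of [f] has the column [coords (f e`_j)] in position [j], so this
   lists its entries column by column: f_11, f_21, f_31, f_12, ..., f_33. *)
Definition vec_end f : 'cV[K]_9 := stack (f e`_0) (f e`_1) (f e`_2).

Definition stack_delta mu f : 'cV[K]_9 :=
  stack (delta mu f e`_0 e`_1) (delta mu f e`_0 e`_2) (delta mu f e`_1 e`_2).

(* The endomorphism whose matrix has a 1 in position [(i, j)] and 0 elsewhere,
   that is, mapping e_j to e_i and the other basis vectors to 0. *)
Definition elem_end (i j : 'I_3) : 'End(V) :=
  linfun (fun x : V => coord e j x *: e`_i).

(* Entry [l] of [vec_end f] (counting from 0) is the matrix entry of [f] in row
   [l %% 3] and column [l %/ 3]. Column [l] of [M_mu] is thus forced by taking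
   for [f] the corresponding elementary endomorphism; [M_muP] and [M_mu_uniq]
   show that [M_mu] is the only matrix with
   [M_mu *m vec_end f = stack_delta mu f] for all [f]. *)
Definition M_mu mu : 'M[K]_9 :=
  \matrix_(k, l) stack_delta mu (elem_end (inord (l %% 3)) (inord (l %/ 3))) k 0.

Hypothesis e_basis : basis_of fullv e.

Let e_free : free e := basis_free e_basis.

Lemma elem_endE i j x : elem_end i j x = coord e j x *: e`_i.
Proof.
have lin : linear (fun x : V => coord e j x *: e`_i).
  by move=> a u v /=; rewrite linearP scalerDl scalerA.
pose g : {linear V -> V} :=
  HB.pack (fun x : V => coord e j x *: e`_i)
    (GRing.isSemilinear.Build K V V _ _ (GRing.semilinear_linear lin)).
exact: (lfunE g x).
Qed.

Lemma stackE x y z (k : 'I_9) :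
  stack x y z k 0 = coord e (inord (k %% 3)) (nth 0 [:: x; y; z] (k %/ 3)).
Proof.
have divE q (i : 'I_3) : ((q * 3 + i) %/ 3 = q)%N.
  by rewrite divnMDl // divn_small // addn0.
have modE q (i : 'I_3) : inord ((q * 3 + i) %% 3) = i :> 'I_3.
  by rewrite modnMDl modn_small // inord_val.
rewrite /stack; case: (@split_ordP (3 + 3) 3 k) => i ->; last first.
  have -> : rshift (3 + 3) i = (2 * 3 + i)%N :> nat by [].
  by rewrite divE modE /= (@col_mxEd _ (3 + 3) 3) mxE.
rewrite (@col_mxEu _ (3 + 3) 3); case: (@split_ordP 3 3 i) => {}i ->.
  have -> : lshift 3 (lshift 3 i) = (0 * 3 + i)%N :> nat by [].
  by rewrite divE modE /= col_mxEu mxE.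
have -> : lshift 3 (rshift 3 i) = (1 * 3 + i)%N :> nat by [].
by rewrite divE modE /= col_mxEd mxE.
Qed.

Lemma stack_delta_is_linear mu : linear (stack_delta mu).
Proof.
have dlin a f g x y :
    delta mu (a *: f + g) x y = a *: delta mu f x y + delta mu g x y.
  rewrite /delta !(add_lfunE, scale_lfunE) linearDl linearDr linearZl_LR.
  rewrite linearZr_LR scalerBr scalerDr opprD.
  rewrite (addrACA (a *: mu (f x) y)).
  by rewrite (addrACA (a *: mu (f x) y + a *: mu x (f y))).
move=> a f g; apply/colP=> k; rewrite [RHS]mxE [X in _ = X + _]mxE.
rewrite /stack_delta !stackE !dlin.
have: (k %/ 3 < 3)%N by rewrite ltn_divLR.
by case: (k %/ 3)%N => [|[|[|]]] //= _; rewrite linearP.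
Qed.

Lemma vec_endE f (l : 'I_9) :
  vec_end f l 0 = coord e (inord (l %% 3)) (f e`_(l %/ 3)).
Proof.
rewrite /vec_end stackE; have: (l %/ 3 < 3)%N by rewrite ltn_divLR.
by case: (l %/ 3)%N => [|[|[|]]].
Qed.

Lemma sum9 (W : zmodType) (G : 'I_3 -> 'I_3 -> W) :
  \sum_(l < 9) G (inord (l %% 3)) (inord (l %/ 3)) = \sum_j \sum_i G i j.
Proof.
have sum3 (H : 'I_3 -> W) :
    \sum_i H i = H (inord 0) + H (inord 1) + H (inord 2).
  rewrite !big_ord_recr big_ord0 /= add0r.
  by congr (H _ + H _ + H _); apply: val_inj; rewrite /= inordK.
by rewrite !sum3 !big_ord_recr big_ord0 /= add0r !addrA.
Qed.

Lemma end_sum_elem f :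
  f = \sum_(l < 9) vec_end f l 0 *: elem_end (inord (l %% 3)) (inord (l %/ 3)).
Proof.
transitivity
  (\sum_(j < 3) \sum_(i < 3) coord e i (f e`_j) *: elem_end i j); last first.
  rewrite -sum9; apply: eq_bigr => l _.
  by rewrite vec_endE /= inordK // ltn_divLR.
apply/lfunP=> x; rewrite [in LHS](coord_basis e_basis (memvf x)) linear_sum.
rewrite sum_lfunE; apply: eq_bigr => j _; rewrite sum_lfunE linearZ /=.
rewrite [in LHS](coord_basis e_basis (memvf (f e`_j))) scaler_sumr.
apply: eq_bigr => i _.
by rewrite scale_lfunE elem_endE !scalerA mulrC.
Qed.

Lemma M_muP mu f : M_mu mu *m vec_end f = stack_delta mu f.
Proof.
pose g : {linear 'End(V) -> 'cV[K]_9} :=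
  HB.pack (stack_delta mu) (GRing.isSemilinear.Build K 'End(V) 'cV[K]_9 _ _
    (GRing.semilinear_linear (@stack_delta_is_linear mu))).
rewrite -[RHS]/(g f) [in RHS](end_sum_elem f) linear_sum.
apply/colP=> k; rewrite mxE summxE; apply: eq_bigr => l _.
by rewrite linearZ /= !mxE mulrC.
Qed.

Lemma vec_end_elem (l : 'I_9) :
  vec_end (elem_end (inord (l %% 3)) (inord (l %/ 3))) = delta_mx l 0.
Proof.
have lt3 (k : 'I_9) : (k %/ 3 < 3)%N by rewrite ltn_divLR.
apply/colP=> k; rewrite vec_endE elem_endE linearZ /= !mxE eqxx andbT.
rewrite -[(k %/ 3)%N](inordK (lt3 k)) !coord_free // -natrM mulnb.
rewrite -!val_eqE /= !inordK ?ltn_mod ?lt3 //; congr (_%:R); congr nat_of_bool.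
apply/andP/eqP=> [[/eqP kd /eqP km]|-> //].
by rewrite (divn_eq k 3) (divn_eq l 3) kd km.
Qed.

Lemma M_mu_uniq mu (M : 'M[K]_9) :
  (forall f, M *m vec_end f = stack_delta mu f) -> M = M_mu mu.
Proof.
move=> MP; apply/matrixP=> k l; by rewrite mxE -MP vec_end_elem -colE mxE.
Qed.

End Algebra.

(* Main.v *)
(** A derivation of [(V, mu)] gives a vector in the kernel of [M_mu], so three
    linearly independent derivations suffice. If the centre is trivial, the
    inner derivations of a basis do. Otherwise let [z != 0] be central: all
    brackets are multiples of a single vector, and [z] extends to a basis
    [(z, p, q)] such that [mu p q] is a multiple of [z] or of [p]. If [E_ij]
    maps the [j]-th basis vector to the [i]-th and kills the others, then
    [E_02], [E_12] and either [E_01] or [E_00] are derivations. *)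
Require Import Defs.
From mathcomp Require Import all_boot all_order all_algebra.

Set Implicit Arguments.
Unset Strict Implicit.
Unset Printing Implicit Defensive.

Import GRing.Theory.
Local Open Scope ring_scope.

(** * Bases and elementary endomorphisms *)

Lemma free_extend (K : fieldType) (V : vectType K) (X : seq V) :
  free X ->
  exists2 Y : seq V, basis_of {:V} (X ++ Y) & size Y = (\dim {:V} - size X)%N.
Proof.
move=> X_free; set U := (<<X>>^C)%VS; exists (vbasis U).
  rewrite basisEdim span_cat (span_basis (vbasisP U)) addv_complf subvv /=.
  rewrite size_cat [size (vbasis U)]size_tuple dimv_compl (eqP X_free).
  by rewrite subnKC // -(eqP X_free) dimvS // subvf.
by rewrite size_tuple dimv_compl (eqP X_free).
Qed.

Lemma free_elem_end (K : fieldType) (V : vectType K) (b : 3.-tuple V)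
    (s : seq ('I_3 * 'I_3)) :
  basis_of {:V} b -> uniq s -> free [seq elem_end b p.1 p.2 | p <- s].
Proof.
move=> b_basis s_uniq; apply/(@freeP _ _ _ (map_tuple _ (in_tuple s))) => c c0 k.
have b_free := basis_free b_basis.
pose p := tnth (in_tuple s) k.
have: coord b p.1
    ((\sum_i c i *: (map_tuple (fun p => elem_end b p.1 p.2) (in_tuple s))`_i)
       b`_p.2) = 0 by rewrite c0 lfunE linear0.
rewrite sum_lfunE linear_sum (bigD1 k) //= big1 => [|i ik].
  rewrite addr0 scale_lfunE linearZ /= (nth_map p) // elem_endE //.
  rewrite -(tnth_nth _ (in_tuple s)) -/p linearZ /= !coord_free // !eqxx.
  by rewrite !mulr1.
rewrite scale_lfunE linearZ /= (nth_map p) // elem_endE // linearZ /=.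
rewrite -(tnth_nth _ (in_tuple s)) !coord_free // -natrM mulnb.
(* Since [s] is duplicate-free, equal pairs have equal indices. *)
have -> : (p.2 == (tnth (in_tuple s) i).2) &&
          ((tnth (in_tuple s) i).1 == p.1) = (i == k).
  rewrite -(inj_eq (tuple_uniqP (in_tuple s) s_uniq)) -/p andbC eq_sym.
  by rewrite [RHS]eq_sym -pair_eqE.
by rewrite (negPf ik) mulr0.
Qed.

(** * Derivations as kernel vectors of [M_mu] *)

Definition derivation (K : fieldType) (V : vectType K)
    (mu : {bilinear V -> V -> V}) (f : 'End(V)) : Prop :=
  forall x y, delta mu f x y = 0.

Lemma vec_end_inj (K : fieldType) (V : vectType K) (e : 3.-tuple V) :
  basis_of {:V} e -> injective (vec_end e).
Proof.
move=> e_basis f g fg.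
by rewrite (end_sum_elem e_basis f) fg -end_sum_elem.
Qed.

Lemma vec_end_sum (K : fieldType) (V : vectType K) (e : 3.-tuple V) n
    (c : 'I_n -> K) (X : 'I_n -> 'End(V)) k :
  vec_end e (\sum_i c i *: X i) k 0 = \sum_i c i * vec_end e (X i) k 0.
Proof.
rewrite vec_endE sum_lfunE linear_sum /=; apply: eq_bigr => i _.
by rewrite vec_endE scale_lfunE linearZ.
Qed.

Lemma rank_M_mu_derivations (K : fieldType) (V : vectType K) (e : 3.-tuple V)
    (mu : {bilinear V -> V -> V}) n (X : n.-tuple 'End(V)) :
    basis_of {:V} e -> free X -> (forall i : 'I_n, derivation mu X`_i) ->
  (\rank (M_mu e mu) + n <= 9)%N.
Proof.
move=> e_basis /freeP X_free X_der.
pose B : 'M[K]_(9, n) := \matrix_(k, i) vec_end e X`_i k 0.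
have MB0 : M_mu e mu *m B = 0.
  apply/matrixP=> k i; rewrite [RHS]mxE.
  transitivity (stack_delta e mu X`_i k 0).
    rewrite -(M_muP e_basis) [LHS]mxE [RHS]mxE.
    by apply: eq_bigr => l _; rewrite [B _ _]mxE.
  rewrite /stack_delta !X_der stackE.
  by case: (k %/ 3)%N => [|[|[|?]]]; rewrite /= ?nth_nil linear0.
have B_rank : \rank B = n.
  rewrite -mxrank_tr; apply/eqP; rewrite -/(row_free _).
  apply: inj_row_free => v vB0; apply/rowP=> i; rewrite [RHS]mxE.
  apply: (X_free (v 0)); apply: (vec_end_inj e_basis); apply/colP=> k.
  have -> : vec_end e 0 k 0 = 0 by rewrite vec_endE lfunE linear0.
  transitivity ((v *m B^T) 0 k); last by rewrite vB0 mxE.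
  by rewrite vec_end_sum mxE; apply: eq_bigr => l _; rewrite !mxE.
rewrite -[X in (_ + X)%N]B_rank; exact: mulmx0_rank_max.
Qed.

(** * Inner derivations and the centerless case *)

Lemma skew_alternating (K : fieldType) (V : vectType K)
    (mu : {bilinear V -> V -> V}) :
  2%N \notin [pchar K] -> skew_symmetric mu -> forall x, mu x x = 0.
Proof.
move=> charK mu_skew x.
have two_neq0 : 2%:R != 0 :> K by apply: contra charK => ?; rewrite inE.
apply/eqP; rewrite -(inj_eq (scalerI two_neq0)) scaler0 scaler_nat mulr2n.
by rewrite {1}mu_skew addNr.
Qed.

Lemma ad_derivation (K : fieldType) (V : vectType K)
    (mu : {bilinear V -> V -> V}) x :
  lie_algebra mu -> derivation mu (linfun (mu x)).
Proof.
move=> [mu_skew mu_jacobi] y z; rewrite /delta !lfunE /=.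
rewrite -(mu_jacobi x y z) -!addrA; congr (_ + _).
rewrite addrC (mu_skew x (mu y z)) opprK; congr (_ + _).
by rewrite mu_skew (mu_skew x z) linearNl opprK.
Qed.

Lemma rank_M_mu_centerless (K : fieldType) (V : vectType K) (e : 3.-tuple V)
    (mu : {bilinear V -> V -> V}) :
    basis_of {:V} e -> lie_algebra mu ->
    (forall z, (forall x, mu z x = 0) -> z = 0) ->
  (\rank (M_mu e mu) <= 6)%N.
Proof.
move=> e_basis mu_lie centerless; rewrite -(leq_add2r 3).
apply: (@rank_M_mu_derivations _ _ _ _ _ (map_tuple (fun x => linfun (mu x)) e)).
- by [].
- apply/freeP=> c c0.
  (* By bilinearity, a vanishing combination of the maps
     [mu e]_i[makes the same combination of the]e[_i] central, hence zero. *)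
  have /freeP e_free := basis_free e_basis; apply: e_free.
  apply: centerless => x; rewrite linear_sumlz.
  move/lfunP/(_ x): c0; rewrite sum_lfunE [RHS]lfunE => c0x.
  rewrite -[RHS]c0x; apply: eq_bigr => i _.
  rewrite linearZl_LR scale_lfunE (nth_map 0) ?size_tuple //.
  by rewrite lfunE.
- by move=> i; rewrite (nth_map 0) ?size_tuple //; apply: ad_derivation.
Qed.

(** * Algebras with a nonzero central vector *)

Section Center.
Variables (K : fieldType) (V : vectType K) (mu : {bilinear V -> V -> V}).
Hypotheses (mu_skew : skew_symmetric mu) (mu_alt : forall x, mu x x = 0).

Section Basis.
Variables z p q : V.
Let b : 3.-tuple V := [tuple z; p; q].
Hypotheses (b_basis : basis_of {:V} b) (z_central : forall x, mu z x = 0).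

Let i0 : 'I_3 := inord 0.
Let i1 : 'I_3 := inord 1.
Let i2 : 'I_3 := inord 2.

Lemma coord_decomp x :
  x = coord b i0 x *: z + coord b i1 x *: p + coord b i2 x *: q.
Proof.
rewrite {1}(coord_basis b_basis (memvf x)) !big_ord_recr big_ord0 /= add0r.
by congr (coord b _ x *: _ + coord b _ x *: _ + coord b _ x *: _);
  apply: val_inj; rewrite /= inordK.
Qed.

(** Expanding in the basis, every term with [z] or with a repeated vector vanishes, which leaves a 2
    by 2 minor. In particular all brackets lie on the line of [mu p q]. *)
Lemma bracket_central_basis x y :
  mu x y =
  (coord b i1 x * coord b i2 y - coord b i2 x * coord b i1 y) *: mu p q.
Proof.
rewrite {1}(coord_decomp x) {1}(coord_decomp y).
rewrite !(linearDl, linearDr) !linearZl_LR !linearZr_LR /=.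
rewrite !z_central !mu_alt (mu_skew p z) (mu_skew q z) (mu_skew q p) !z_central.
rewrite oppr0 !scaler0 !add0r !addr0 !scalerN !scalerA scalerBl.
by rewrite addrC.
Qed.

(** The image is spanned by the central [z], so the first two terms of [delta] vanish; the third is
    a multiple of [coord b j (mu p q)]. *)
Lemma elem_end_0_derivation j :
  coord b j (mu p q) = 0 -> derivation mu (elem_end b i0 j).
Proof.
move=> cj0 x y; rewrite /delta !elem_endE // inordK //= !linearZl_LR /=.
rewrite linearZr_LR /= z_central (mu_skew x z) z_central oppr0 !scaler0 !add0r.
rewrite bracket_central_basis [coord _ _ (_ *: _)]linearZ /=.
by rewrite cj0 mulr0 scale0r oppr0.
Qed.

(** The map sends [q] to [p], so the first two terms of [delta] are opposite multiples of [mu p q],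
    with coefficient the product of the [q]-coordinates of [x] and [y]. The hypothesis kills the
    third. *)
Lemma elem_end_12_derivation :
  coord b i2 (mu p q) = 0 -> derivation mu (elem_end b i1 i2).
Proof.
move=> c20 x y; rewrite /delta !elem_endE // inordK //= linearZl_LR /=.
rewrite linearZr_LR /= (bracket_central_basis p y) (bracket_central_basis x p).
rewrite (bracket_central_basis x y).
rewrite [coord _ _ (_ *: _)]linearZ /= c20 mulr0 scale0r subr0.
have [c1p c2p] : coord b i1 p = 1 /\ coord b i2 p = 0.
  have p_nth : p = b`_i1 by rewrite inordK.
  by rewrite p_nth !coord_free ?(basis_free b_basis) // eqxx -val_eqE /= !inordK.
rewrite c1p c2p !scalerA -scalerDl mul1r mul0r mulr0 mulr1 subr0 sub0r.
by rewrite mulrN mulrC subrr scale0r.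
Qed.

(** The index [j] is 1 when [mu p q] is a multiple of [z], and 0 when it is a multiple of [p];
    [j != i2] keeps the three maps distinct. *)
Lemma rank_M_mu_central_basis (e : 3.-tuple V) (j : 'I_3) :
    basis_of {:V} e -> j != i2 -> coord b i2 (mu p q) = 0 ->
    coord b j (mu p q) = 0 ->
  (\rank (M_mu e mu) <= 6)%N.
Proof.
move=> e_basis ji2 c20 cj0; rewrite -(leq_add2r 3).
apply: (@rank_M_mu_derivations _ _ _ _ _
  [tuple elem_end b i0 i2; elem_end b i1 i2; elem_end b i0 j]) => //.
  have /(free_elem_end b_basis) : uniq [:: (i0, i2); (i1, i2); (i0, j)].
    rewrite /= !inE !xpair_eqE (eq_sym i2 j) (negPf ji2) !andbF.
    by rewrite -!val_eqE /= !inordK.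
  by [].
case=> [[|[|[|?]]]] //= _.
- exact: elem_end_0_derivation.
- exact: elem_end_12_derivation.
- exact: elem_end_0_derivation.
Qed.

End Basis.

Lemma rank_M_mu_central (e : 3.-tuple V) z :
    \dim {:V} = 3%N -> basis_of {:V} e -> z != 0 -> (forall x, mu z x = 0) ->
  (\rank (M_mu e mu) <= 6)%N.
Proof.
move=> dimV e_basis z_neq0 z_central.
have coord_mem (b : 3.-tuple V) (i j : 'I_3) x : basis_of {:V} b ->
    x \in <[b`_j]>%VS -> j != i -> coord b i x = 0.
  move=> b_basis /vlineP[c ->] ji.
  by rewrite linearZ /= coord_free ?(basis_free b_basis) // (negPf ji) mulr0.
have i012 := (inordK (isT : 0 < 3)%N, inordK (isT : 1 < 3)%N,
  inordK (isT : 2 < 3)%N).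
have [[|u [|v []]]] := free_extend (etrans (seq1_free z) z_neq0);
  rewrite ?dimV //= => b_basis _.
have [w_z|w_z] := boolP (mu u v \in <[z]>%VS).
  apply: (rank_M_mu_central_basis b_basis z_central (j := inord 1)) => //;
    rewrite -?val_eqE /= ?i012 //.
  - by apply: (coord_mem _ _ (inord 0)); rewrite -?val_eqE /= ?i012.
  - by apply: (coord_mem _ _ (inord 0)); rewrite -?val_eqE /= ?i012.
(* Here [w] is independent of [z], so it can replace [p] in a new basis [(z, w, q)]. The formula in
   the old basis [(z, u, v)] then shows that [mu w q] is a multiple of [w]. *)
set w := mu u v in w_z.
have zw_free : free [:: w; z].
  by rewrite free_cons span_seq1 w_z seq1_free.
have [[|q []]] := free_extend zw_free; rewrite ?dimV //= => wzq_basis _.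
have zwq_basis : basis_of {:V} [tuple z; w; q].
  rewrite (perm_basis (Y := [:: w; z; q])) //.
  exact: permEl (perm_catCA [:: z] [:: w] [:: q]).
have w_mem : mu w q \in <[w]>%VS.
  by rewrite (bracket_central_basis b_basis) // memvZ // memv_line.
apply: (rank_M_mu_central_basis zwq_basis z_central (j := inord 0)) => //;
  rewrite -?val_eqE /= ?i012 //.
- by apply: (coord_mem _ _ (inord 1)); rewrite -?val_eqE /= ?i012.
- by apply: (coord_mem _ _ (inord 1)); rewrite -?val_eqE /= ?i012.
Qed.

End Center.

Theorem proposition4 (K : fieldType) (charK : 2%N \notin [pchar K])
    (V : vectType K) (dimV : \dim {:V} = 3%N)
    (e : 3.-tuple V) (e_basis : basis_of {:V} e)
    (mu : {bilinear V -> V -> V}) (mu_skew : skew_symmetric mu)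
    (A_lie : lie_algebra mu) :
  (\rank (M_mu e mu) <= 6)%N.
Proof.
(* If the bound failed, the central case would exclude every nonzero central vector, and the
   centerless case would then give the bound. This avoids deciding whether the centre is trivial. *)
apply: contraT => rank_gt6; rewrite -(negPf rank_gt6).
apply: rank_M_mu_centerless => // z z_central.
apply/eqP; apply: contraNT rank_gt6 => z_neq0.
have mu_alt := skew_alternating charK mu_skew.
exact: (rank_M_mu_central mu_skew mu_alt dimV e_basis z_neq0 z_central).
Qed.
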